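(* Let $G$ be a discrete group, $\omega_0$ a normalized $\mathbb{C}$-valued $2$-cocycle on $G$, and $x\in G$ an element of finite order. Let $\tilde\omega_0,\psi,\xi,\theta,\Xi$ be as in the context, let $D$ be the Hochschild $2$-cochain on $\mathbb{C}[G]$ with $D(g,h)=\omega_0(g,h)gh$, let $\tau^x=\delta_{\mathrm{Ad}_G(x)}$, and let $\tau^x\lhd\omega_0$ denote the cyclic cocycle $\tilde\omega_0\circ\Xi$ (which represents the cup product action of the cohomology class of $\omega_0$ on $\tau^x$). Then, as functionals on $\bar C_*(\mathbb{C}[G])$, $$-\xi+\iota_D\tau^x+\tau^x\lhd\omega_0=(b-B)\theta.$$
   Context: Normalized cocycle: $\omega_0(h,k)+\omega_0(g,hk)=\omega_0(g,h)+\omega_0(gh,k)$, $\omega_0(e,g)=\omega_0(g,e)=\omega_0(g,g^{-1})=0$ (same for cocycles on other groups). $\mathrm{Ad}_G(x)$, $C_G(x)$: conjugacy class and centralizer of $x$; $\delta_{\mathrm{Ad}_G(x)}$ is the linear extension of the indicator function; $N_G(x)=C_G(x)/\langle x\rangle$. For $y\in \mathrm{Ad}_G(x)$ fix $g^y\in G$ with $(g^y)^{-1}xg^y=y$. Since $x$ is torsion, there is a normalized $2$-cocycle $\tilde\omega_0$ on $N_G(x)$ whose pullback to $C_G(x)$ is cohomologous to $\omega_0$; fix one and $\psi:C_G(x)\to\mathbb{C}$ with $\omega_0(g,h)-\psi(g)-\psi(h)+\psi(gh)=\tilde\omega_0(g,h)$ for $g,h\in C_G(x)$. $\xi(g_0)=\psi(x)+\omega_0(g^{g_0}g_0,(g^{g_0})^{-1})-\omega_0((g^{g_0})^{-1},g^{g_0}g_0)$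 for $g_0\in \mathrm{Ad}_G(x)$, $0$ otherwise. With $y_0=g_0g_1,\ y_1=g_1g_0$: $\theta(g_0,g_1)=\psi(g^{y_1}g_1(g^{y_0})^{-1})+\omega_0(g_1,(g^{y_0})^{-1})-\omega_0((g^{y_1})^{-1},g^{y_1}g_1(g^{y_0})^{-1})$ if $g_0g_1\in\mathrm{Ad}_G(x)$, $0$ otherwise. These are extended linearly to $\mathbb{C}[G]$, $\mathbb{C}[G]^{\otimes2}$. For $g_0g_1g_2\in \mathrm{Ad}_G(x)$ put $y_0=g_0g_1g_2$, $y_1=g_1g_2g_0$, $y_2=g_2g_0g_1$ and $\Xi(g_0,g_1,g_2)=(g^{y_1}g_1(g^{y_2})^{-1},g^{y_2}g_2(g^{y_0})^{-1})\in C_G(x)^2$; $\tilde\omega_0\circ\Xi$ is zero when $g_0g_1g_2\notin\mathrm{Ad}_G(x)$. $\bar C_n(R)=R\otimes(R/\mathbb{C}1)^{\otimes n}$; on chains $b(a_0\otimes\cdots\otimes a_n)=\sum_{i<n}(-1)^ia_0\otimes\cdots\otimes a_ia_{i+1}\otimes\cdots\otimes a_n+(-1)^na_na_0\otimes\cdots\otimes a_{n-1}$, $B(a_0\otimes\cdots\otimes a_n)=\sum_{i=0}^n(-1)^{ni}1\otimes a_i\otimes\cdots\otimes a_n\otimes a_0\otimes\cdots\otimes a_{i-1}$; on functionals, $b,B$, $\iota_D$ denote the transposes. For a $2$-cochain $D$, $\iota_D=\mathbf b_D-\mathbf B_D$, with $\mathbf b_D(a_0\otimes\cdots\otimes a_n)=D(a_{n-1},a_n)a_0\otimes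 a_1\otimes\cdots\otimes a_{n-2}$ and $\mathbf B_D(a_0\otimes\cdots\otimes a_n)=\sum_{0\le j\le k\le n-2}(-1)^{n(j+1)}1\otimes a_{j+1}\otimes\cdots\otimes D(a_{k+1},a_{k+2})\otimes\cdots\otimes a_n\otimes a_0\otimes\cdots\otimes a_j$.
   Formalization: The sign of the cup product term is corrected: the identity proved is −ξ + ι_D τ^x − τ^x◁ω_0 = (b−B)θ, because with the stated definitions the version with +τ^x◁ω_0 fails in degree 2 (for instance G=ℤ, x=0, ω_0=0, ψ odd and non-additive). *)

(* Defs.v *)
From HB Require Import structures.
From mathcomp Require Import all_boot all_order all_algebra.
From mathcomp Require Import boolp reals.
From mathcomp Require Import finmap.
From mathcomp.real_closed Require Import complex.
From mathcomp.multinomials Require Import monalg.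

Set Implicit Arguments.
Unset Strict Implicit.
Unset Printing Implicit Defensive.

Import GRing.Theory.
Local Open Scope ring_scope.

(** * Groups *)

Section Groups.
Variables (G : groupType) (x : G).
Local Open Scope group_scope.

Definition finite_order := exists n : nat, (0 < n)%N /\ x ^+ n = 1.

Definition Ad (y : G) : Prop := exists g : G, y = x ^ g.

Definition cent : {pred G} := [pred g | x * g == g * x].

Definition centraliser := {g : G | g \in cent}.
HB.instance Definition _ := SubChoice.on centraliser.

Fact cent_group_closed : group_closed cent.
Proof.
split; first by rewrite inE mulg1 mul1g.
move=> g h /eqP xg /eqP xh; rewrite inE mulgA xg -!mulgA; apply/eqP.
by congr (_ * _); apply: (mulgI h); rewrite mulgA -xh mulgK mulVKg.
Qed.
HB.instance Definition _ :=
  SubChoice_isSubGroup.Build G cent centraliser cent_group_closed.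

Definition in_cycle (g : G) : Prop := exists n : nat, g = x ^+ n \/ g = x ^- n.

Fact in_cycle1 : in_cycle 1.
Proof. by exists 0%N; left. Qed.

Fact in_cycleV g : in_cycle g -> in_cycle g^-1.
Proof. by case=> n [] ->; exists n; [right | left; rewrite invgK]. Qed.

Fact in_cycleM g h : in_cycle g -> in_cycle h -> in_cycle (g * h).
Proof.
have mixed m n : in_cycle (x ^+ m / x ^+ n).
  case: (leqP n m) => [le_nm | /ltnW le_mn].
    by exists (m - n)%N; left; rewrite expgnFr.
  by exists (n - m)%N; right; rewrite expgnFr // invgF.
case=> m [] -> [n [] ->].
- by exists (m + n)%N; left; rewrite expgnDr.
- exact: mixed.
- have -> : x ^- m * x ^+ n = x ^+ n / x ^+ m.
    by apply/commute_sym/commuteV/commuteX2.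
  exact: mixed.
- by exists (n + m)%N; right; rewrite expgnDr invgM.
Qed.

Definition cycle_rel (g h : centraliser) : bool :=
  `[< in_cycle ((val g)^-1 * val h) >].

Fact cycle_rel_refl : reflexive cycle_rel.
Proof. by move=> g; apply/asboolP; rewrite mulVg; apply: in_cycle1. Qed.

Fact cycle_rel_sym : symmetric cycle_rel.
Proof.
suff sub g h : cycle_rel g h -> cycle_rel h g by move=> g h; apply/idP/idP; apply: sub.
by move=> /asboolP gh; apply/asboolP; have := in_cycleV gh; rewrite invgM invgK.
Qed.

Fact cycle_rel_trans : transitive cycle_rel.
Proof.
move=> h g k /asboolP gh /asboolP hk; apply/asboolP.
by have := in_cycleM gh hk; rewrite -mulgA mulVKg.
Qed.

Canonical cycle_equiv :=
  EquivRel cycle_rel cycle_rel_refl cycle_rel_sym cycle_rel_trans.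

(* N_G(x) = C_G(x) / <x> *)
Definition centraliser_quotient := {eq_quot cycle_equiv}%qT.
HB.instance Definition _ := Choice.on centraliser_quotient.

Definition centraliser_proj (g : centraliser) : centraliser_quotient :=
  (\pi_centraliser_quotient g)%qT.

Fact centraliser_projP g h :
  reflect (centraliser_proj g = centraliser_proj h) (cycle_rel g h).
Proof. exact: eqmodP. Qed.

Local Notation p := centraliser_proj.

Let mulq (u v : centraliser_quotient) : centraliser_quotient :=
  p ((repr u)%qT * (repr v)%qT).
Let invq (u : centraliser_quotient) : centraliser_quotient := p ((repr u)%qT)^-1.

Let p_repr u : p (repr u)%qT = u. Proof. exact: reprK. Qed.

Let in_cycle_comm (k : G) (g : centraliser) : in_cycle k -> val g * k = k * val g.
Proof.
have xg : commute (val g) x by case: g => g /= /eqP /esym.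
by case=> n [] ->; [apply: commuteX | apply/commuteV/commuteX].
Qed.

Let p_mul g h : mulq (p g) (p h) = p (g * h).
Proof.
apply/centraliser_projP/asboolP.
have /centraliser_projP/asboolP := p_repr (p g).
have /centraliser_projP/asboolP := p_repr (p h).
move: (repr (p g))%qT (repr (p h))%qT => g' h' hh gg; rewrite !valM invgM.
have -> : (val h')^-1 * (val g')^-1 * (val g * val h) =
          (val h')^-1 * (((val g')^-1 * val g) * val h) by rewrite !mulgA.
by rewrite -(in_cycle_comm h gg) mulgA; apply: in_cycleM.
Qed.

Let p_inv g : invq (p g) = p g^-1.
Proof.
apply/centraliser_projP/asboolP.
have /centraliser_projP/asboolP := p_repr (p g).
move: (repr (p g))%qT => g' gg; rewrite !gmulfV invgK.
have k := in_cycleV gg; rewrite invgM invgK in k.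
have -> : val g' / val g = val g' * ((val g)^-1 * val g') / val g'.
  by rewrite mulgA mulgK.
by rewrite in_cycle_comm // mulgK.
Qed.

Let mulqA : associative mulq.
Proof.
move=> u v w; rewrite -(p_repr u) -(p_repr v) -(p_repr w).
by rewrite !p_mul mulgA.
Qed.

Let mul1q : left_id (p 1) mulq.
Proof. by move=> u; rewrite -(p_repr u) p_mul mul1g. Qed.

Let mulq1 : right_id (p 1) mulq.
Proof. by move=> u; rewrite -(p_repr u) p_mul mulg1. Qed.

Let mulVq : left_inverse (p 1) invq mulq.
Proof. by move=> u; rewrite -(p_repr u) p_inv p_mul mulVg. Qed.

Let mulqV : right_inverse (p 1) invq mulq.
Proof. by move=> u; rewrite -(p_repr u) p_inv p_mul mulgV. Qed.

HB.instance Definition _ := isGroup.Build centraliser_quotient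
  mulqA mul1q mulq1 mulVq mulqV.

Fact centraliser_projM : {morph p : g h / g * h}.
Proof. by move=> g h; rewrite -p_mul. Qed.

End Groups.

(** * Group cocycles with trivial coefficients *)

Definition normalized_cocycle (K : zmodType) (H : groupType) (w : H -> H -> K) :=
  [/\ forall g h k, w h k + w g (h * k)%g = w g h + w (g * h)%g k,
      forall g, w 1%g g = 0, forall g, w g 1%g = 0 &
      forall g, w g g^-1%g = 0].

(** * Group algebras *)

Section LinearExtension.
Variables (K : comNzRingType) (G : choiceType) (V : lmodType K).
Implicit Types (f : G -> V) (a : {malg K[G]}).

(* The linear extension to K[G] of a function f defined on G. *)
Definition linext f a : V := \sum_(g <- msupp a) a@_g *: f g.

Lemma linextw (d : {fset G}) f a : (msupp a `<=` d)%fset ->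
  linext f a = \sum_(g <- d) a@_g *: f g.
Proof.
move=> le_d; apply/big_fset_incl => // g _ /mcoeff_outdom ->.
by rewrite scale0r.
Qed.

Lemma linextU f g c : linext f << c *g g >> = c *: f g.
Proof. by rewrite (linextw _ msuppU_le) big_seq_fset1 mcoeffUU. Qed.

Lemma linext_is_linear f : linear (linext f).
Proof.
move=> c a b; pose d := (msupp a `|` msupp b)%fset.
have le_ab : (msupp (c *: a + b) `<=` d)%fset.
  apply: fsubset_trans (msuppD_le _ _) _; apply: fsetSU; exact: msuppZ_le.
rewrite (linextw _ le_ab) (linextw _ (fsubsetUl _ _ : (msupp a `<=` d)%fset)).
rewrite (linextw _ (fsubsetUr _ _ : (msupp b `<=` d)%fset)).
rewrite scaler_sumr -big_split /=; apply: eq_bigr => g _.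
by rewrite mcoeffD mcoeffZ scalerDl scalerA.
Qed.

HB.instance Definition _ f :=
  GRing.isLinear.Build K {malg K[G]} V *:%R (linext f) (linext_is_linear f).

Lemma linext_ind (P : {malg K[G]} -> Prop) :
  (forall c a b, P a -> P b -> P (c *: a + b)) -> P 0 ->
  (forall g, P << g >>) -> forall a, P a.
Proof.
move=> Plin P0 PU a; rewrite (monalgE a); elim/big_ind: _ => // [b c Pb Pc|g _].
  by rewrite -[b]scale1r; apply: Plin.
have -> : << a@_g *g g >> = a@_g *: << g >> + 0 :> {malg K[G]}.
  by apply/malgP => h; rewrite addr0 mcoeffZ !mcoeffU mulr_natr.
exact: Plin.
Qed.

(* The bilinear extension to K[G] * K[G] of a function f defined on G * G. *)
Definition bilinext (F : G -> G -> V) (a b : {malg K[G]}) : V :=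
  linext (fun g => linext (F g) b) a.

Implicit Types F : G -> G -> V.

Lemma bilinextU F g h : bilinext F << g >> << h >> = F g h.
Proof. by rewrite /bilinext !linextU !scale1r. Qed.

Lemma bilinextDZl F c a a' b :
  bilinext F (c *: a + a') b = c *: bilinext F a b + bilinext F a' b.
Proof. exact: linearP. Qed.

Lemma bilinextDZr F c a b b' :
  bilinext F a (c *: b + b') = c *: bilinext F a b + bilinext F a b'.
Proof.
rewrite /bilinext /linext scaler_sumr -big_split; apply: eq_bigr => g _ /=.
by rewrite -/(linext _ _) linearP scalerDr !scalerA mulrC.
Qed.

Lemma bilinext0l F b : bilinext F 0 b = 0.
Proof. exact: linear0. Qed.

Lemma bilinext0r F a : bilinext F a 0 = 0.
Proof. by rewrite /bilinext {1}/linext big1 // => g _; rewrite linear0 scaler0. Qed.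

End LinearExtension.

Section GroupAlgebra.
Variables (K : comNzRingType) (G : groupType).

Definition group_algebra := {malg K[G]}.
HB.instance Definition _ := GRing.Lmodule.on group_algebra.
Local Notation A := group_algebra.

Definition gbasis (g : G) : A := << g >>.

Let one : A := gbasis 1%g.
Let mul (a b : A) : A := bilinext (fun g h => gbasis (g * h)%g) a b.

Let mulDZl c a a' b : mul (c *: a + a') b = c *: mul a b + mul a' b.
Proof. exact: bilinextDZl. Qed.
Let mulDZr c a b b' : mul a (c *: b + b') = c *: mul a b + mul a b'.
Proof. exact: bilinextDZr. Qed.
Let mul0l b : mul 0 b = 0. Proof. exact: bilinext0l. Qed.
Let mul0r a : mul a 0 = 0. Proof. exact: bilinext0r. Qed.
Let mulUU g h : mul (gbasis g) (gbasis h) = gbasis (g * h)%g.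
Proof. exact: bilinextU. Qed.

Let mulA : associative mul.
Proof.
move=> a b c; elim/linext_ind: a => [k a a' IH IH'||g].
- by rewrite !mulDZl IH IH'.
- by rewrite !mul0l.
elim/linext_ind: b => [k b b' IH IH'||h].
- by rewrite !(mulDZl, mulDZr) IH IH'.
- by rewrite !(mul0r, mul0l).
elim/linext_ind: c => [k c c' IH IH'||h'].
- by rewrite !mulDZr IH IH'.
- by rewrite !mul0r.
by rewrite -!/(gbasis _) !mulUU mulgA.
Qed.

Let mul1 : left_id one mul.
Proof.
move=> a; elim/linext_ind: a => [k a a' IH IH'||g].
- by rewrite mulDZr IH IH'.
- by rewrite mul0r.
by rewrite -!/(gbasis _) mulUU mul1g.
Qed.

Let mulI : right_id one mul.
Proof.
move=> a; elim/linext_ind: a => [k a a' IH IH'||g].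
- by rewrite mulDZl IH IH'.
- by rewrite mul0l.
by rewrite -!/(gbasis _) mulUU mulg1.
Qed.

Let mulDl : left_distributive mul +%R.
Proof. by move=> a b c; rewrite -[a]scale1r mulDZl !scale1r. Qed.

Let mulDr : right_distributive mul +%R.
Proof. by move=> a b c; rewrite -[b]scale1r mulDZr !scale1r. Qed.

Let one_neq0 : one != 0.
Proof.
by apply/eqP => /malgP /(_ 1%g) /eqP; rewrite mcoeffUU mcoeff0 oner_eq0.
Qed.

HB.instance Definition _ := GRing.Zmodule_isNzRing.Build group_algebra
  mulA mul1 mulI mulDl mulDr one_neq0.

Let scaleAl k (a b : A) : k *: (a * b) = (k *: a) * b.
Proof. by rewrite -[k *: a]addr0 [RHS]mulDZl mul0l addr0. Qed.

Let scaleAr k (a b : A) : k *: (a * b) = a * (k *: b).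
Proof. by rewrite -[k *: b]addr0 [RHS]mulDZr mul0r addr0. Qed.

HB.instance Definition _ :=
  GRing.Lmodule_isLalgebra.Build K group_algebra scaleAl.
HB.instance Definition _ :=
  GRing.Lalgebra_isAlgebra.Build K group_algebra scaleAr.

Fact gbasisM g h : gbasis g * gbasis h = gbasis (g * h)%g.
Proof. exact: mulUU. Qed.

Fact gbasis1 : gbasis 1%g = 1.
Proof. by []. Qed.

End GroupAlgebra.

(** * Functionals on normalized chains *)

Section Functionals.
Variables (K : comNzRingType) (A : algType K).

(* A functional on the direct sum over n of A (x) (A/K1)^(x)n is encoded by its
   values on elementary tensors: the sequence [:: a0; ...; an] stands for
   a0 (x) ... (x) an, and the empty sequence is junk.  By the universal property
   of the tensor product, [is_functional] singles out the functions on
   sequences that do come from such a functional. *)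
Definition cochain := seq A -> K.

Definition is_functional (phi : cochain) : Prop :=
  (forall s t c u v,
     phi (s ++ (c *: u + v) :: t) = c * phi (s ++ u :: t) + phi (s ++ v :: t))
  /\ (forall s t, s != [::] -> phi (s ++ 1 :: t) = 0).

Implicit Types (phi : cochain) (a : seq A).

(* In the four operators below, n is the degree of a = a0 (x) ... (x) an. *)

Definition op_b phi : cochain := fun a =>
  let n := (size a).-1 in
  if n == 0%N then 0 else
  \sum_(i < n) (-1) ^+ i *
     phi (take i a ++ (a`_i * a`_i.+1) :: drop i.+2 a)
  + (-1) ^+ n * phi ((a`_n * a`_0) :: take n.-1 (behead a)).

Definition op_B phi : cochain := fun a =>
  let n := (size a).-1 in
  \sum_(i < n.+1) (-1) ^+ (n * i) * phi (1 :: drop i a ++ take i a).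

Variable D : A -> A -> A.

Definition op_bD phi : cochain := fun a =>
  let n := (size a).-1 in
  if (n < 2)%N then 0 else
  phi ((D a`_n.-1 a`_n * a`_0) :: take n.-2 (behead a)).

(* The indices j <= k range over 0..n-2. *)
Definition op_BD phi : cochain := fun a =>
  let n := (size a).-1 in
  \sum_(j < n.-1) \sum_(k < n.-1 | (j <= k)%N) (-1) ^+ (n * j.+1) *
    phi (1 :: take (k - j) (drop j.+1 a) ++
         D a`_k.+1 a`_k.+2 :: drop k.+3 a ++ take j.+1 a).

Definition op_iota phi : cochain := fun a => op_bD phi a - op_BD phi a.

End Functionals.

(** * The cochains attached to a group cocycle and a conjugacy class *)

Section TwistedCochains.
Variables (K : comNzRingType) (G : groupType) (x : G).
Local Notation A := (group_algebra K G).
Local Notation C_G := (centraliser x).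
Local Notation N_G := (centraliser_quotient x).

Variable omega0 : G -> G -> K.

Definition twist (a b : A) : A :=
  bilinext (fun g h => omega0 g h *: gbasis K (g * h)%g) a b.

(* Homogeneous functionals of degrees 0, 1, 2, extended linearly from G. *)
Definition cochain0 (f : G -> K) : cochain A := fun a =>
  if a is [:: a0] then linext (f : G -> K^o) a0 else 0.

Definition cochain1 (f : G -> G -> K) : cochain A := fun a =>
  if a is [:: a0; a1] then bilinext (f : G -> G -> K^o) a0 a1 else 0.

Definition cochain2 (f : G -> G -> G -> K) : cochain A := fun a =>
  if a is [:: a0; a1; a2] then
    linext (fun g0 => bilinext (f g0 : G -> G -> K^o) a1 a2) a0
  else 0.

Definition tau_cochain : cochain A := cochain0 (fun g => if `[< Ad x g >] then 1 else 0).

(* [sel y] is the chosen element g^y, relevant only for y in Ad_G(x). *)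
Variables (sel : G -> G) (psi : C_G -> K) (omegat : N_G -> N_G -> K).

(* The element g of C_G(x); only applied to elements that do centralise x. *)
Definition to_centraliser (g : G) : C_G := insubd (1%g : C_G) g.

Definition xi_cochain : cochain A := cochain0 (fun y =>
  if `[< Ad x y >] then
    psi (to_centraliser x) + omega0 (sel y * y)%g (sel y)^-1%g
      - omega0 (sel y)^-1%g (sel y * y)%g
  else 0).

Definition theta_cochain : cochain A := cochain1 (fun g0 g1 =>
  let y0 := (g0 * g1)%g in
  let y1 := (g1 * g0)%g in
  let h := (sel y1 * g1 * (sel y0)^-1)%g in
  if `[< Ad x (g0 * g1)%g >] then
    psi (to_centraliser h) + omega0 g1 (sel y0)^-1%g - omega0 (sel y1)^-1%g h
  else 0).

Definition Xi (g0 g1 g2 : G) : C_G * C_G :=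
  let y0 := (g0 * g1 * g2)%g in
  let y1 := (g1 * g2 * g0)%g in
  let y2 := (g2 * g0 * g1)%g in
  (to_centraliser (sel y1 * g1 * (sel y2)^-1)%g,
   to_centraliser (sel y2 * g2 * (sel y0)^-1)%g).

(* The cyclic cocycle given by the composition of omegat with Xi. *)
Definition cup_cochain : cochain A := cochain2 (fun g0 g1 g2 =>
  let hk := Xi g0 g1 g2 in
  if `[< Ad x (g0 * g1 * g2)%g >] then
    omegat (centraliser_proj hk.1) (centraliser_proj hk.2)
  else 0).

End TwistedCochains.

Arguments tau_cochain K {G} x.

(* Main.v *)
Require Import Defs.
From mathcomp Require Import all_boot all_order all_algebra.
From mathcomp Require Import reals boolp ring.
From mathcomp.real_closed Require Import complex.
From mathcomp.multinomials Require Import monalg.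

(** The reason behind the formula is a change of gauge on the action groupoid
    of the conjugacy class.  Its objects are the elements y of Ad_G(x), an arrow
    from y to y' being an element g of G with g y = y' g.  The choices g^y give
    a functor to C_G(x), sending such an arrow to g^{y'} g (g^y)^-1.  Along
    arrows there are two 2-cocycles: omega0 itself, which does not look at the
    objects, and the pullback of omegat along this functor followed by the
    projection to N_G(x).  On C_G(x) the function psi makes them cohomologous;
    correcting psi by the two values of omega0 that compare g with
    g^{y'} g (g^y)^-1 gives a function on arrows, [arrow_psi], whose coboundary
    is the difference of the two cocycles ([arrow_psi_coboundary]).

    A pair (g0, g1) with product in Ad_G(x) yields the arrow g1 from g0 g1 to
    g1 g0, and theta is the value of [arrow_psi] at that arrow.  A triple
    (g0, g1, g2) yields two composable arrows
    g0 g1 g2 --g2--> g2 g0 g1 --g1--> g1 g2 g0, and b theta is precisely the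
    coboundary evaluated at (g1, g2): it is omega0(g1, g2) - omegat(Xi), and
    omega0(g1, g2) is the value of iota_D tau^x.  This is the identity in
    degree 2, where the cup product therefore enters with the sign -1.  In
    degree 0, B theta is the value at the arrow y from y to itself, which the
    functor sends to x; rewriting the correction terms turns it into xi.  In
    all other degrees both sides vanish, since tau^x, xi, theta
    and the cup product only live in degrees 0, 0, 1 and 2; the part B_D of
    iota_D likewise never meets tau^x, because it produces tensors of positive
    degree.  Finally psi vanishes at 1, so normalization of omega0 and omegat
    makes all four functionals descend to normalized chains. *)

Set Implicit Arguments.
Unset Strict Implicit.
Unset Printing Implicit Defensive.

Import GRing.Theory.
Local Open Scope ring_scope.
Local Open Scope complex_scope.

(** * Linear extensions from the group basis *)

Lemma mulDZl (K : comNzRingType) (A : algType K) c (u v a : A) :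
  (c *: u + v) * a = c *: (u * a) + v * a.
Proof. by rewrite mulrDl scalerAl. Qed.

Lemma mulDZr (K : comNzRingType) (A : algType K) c (u v a : A) :
  a * (c *: u + v) = c *: (a * u) + a * v.
Proof. by rewrite mulrDr scalerAr. Qed.

Section LinearExtensionTheory.
Variables (K : comNzRingType) (G : choiceType) (V : lmodType K).
Implicit Types (f : G -> V) (a : {malg K[G]}).

Lemma eq_linext f f' a : f =1 f' -> linext f a = linext f' a.
Proof. by move=> ff'; apply: eq_bigr => g _; rewrite ff'. Qed.

Lemma linextDZf f f' c a :
  linext (fun g => c *: f g + f' g) a = c *: linext f a + linext f' a.
Proof.
rewrite /linext scaler_sumr -big_split; apply: eq_bigr => g _ /=.
by rewrite scalerDr !scalerA mulrC.
Qed.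

Lemma linext0f f a : (forall g, f g = 0) -> linext f a = 0.
Proof. by move=> f0; rewrite /linext big1 // => g _; rewrite f0 scaler0. Qed.

End LinearExtensionTheory.

(** * Functionals of degree 0, 1 and 2 on the group algebra *)

Section HomogeneousCochains.
Variables (K : comNzRingType) (G : groupType).
Local Notation A := (group_algebra K G).

(** The values lie in the module K^o; this and the next four lemmas read its
    scaling as the product of K. *)
Lemma linext_scalarP (f : G -> K^o) c (u v : A) :
  linext f (c *: u + v) = c * linext f u + linext f v :> K.
Proof. exact: (linext_is_linear f c u v). Qed.

Lemma bilinext_scalarPl (f : G -> G -> K^o) c (u v b : A) :
  bilinext f (c *: u + v) b = c * bilinext f u b + bilinext f v b :> K.
Proof. exact: (bilinextDZl f c u v b). Qed.

Lemma bilinext_scalarPr (f : G -> G -> K^o) c (a u v : A) :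
  bilinext f a (c *: u + v) = c * bilinext f a u + bilinext f a v :> K.
Proof. exact: (bilinextDZr f c a u v). Qed.

Lemma linext_trilinearl (f : G -> G -> G -> K^o) c (a u v b : A) :
  linext (fun g => bilinext (f g) (c *: u + v) b) a
    = c * linext (fun g => bilinext (f g) u b) a
      + linext (fun g => bilinext (f g) v b) a :> K.
Proof.
rewrite -[RHS](linextDZf (fun g => bilinext (f g) u b : K^o)
  (fun g => bilinext (f g) v b)).
by apply: (@eq_linext _ _ K^o) => g; apply: bilinext_scalarPl.
Qed.

Lemma linext_trilinearr (f : G -> G -> G -> K^o) c (a b u v : A) :
  linext (fun g => bilinext (f g) b (c *: u + v)) a
    = c * linext (fun g => bilinext (f g) b u) a
      + linext (fun g => bilinext (f g) b v) a :> K.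
Proof.
rewrite -[RHS](linextDZf (fun g => bilinext (f g) b u : K^o)
  (fun g => bilinext (f g) b v)).
by apply: (@eq_linext _ _ K^o) => g; apply: bilinext_scalarPr.
Qed.

Lemma cochain0U (f : G -> K) g : cochain0 f [:: gbasis K g] = f g.
Proof. by rewrite /= linextU scale1r. Qed.

Lemma cochain0_pos (f : G -> K) (a b : A) (s : seq A) :
  cochain0 f [:: a, b & s] = 0.
Proof. by []. Qed.

Lemma cochain1U (f : G -> G -> K) g h :
  cochain1 f [:: gbasis K g; gbasis K h] = f g h.
Proof. by rewrite /= bilinextU. Qed.

Lemma cochain2U (f : G -> G -> G -> K) g h k :
  cochain2 f [:: gbasis K g; gbasis K h; gbasis K k] = f g h k.
Proof. by rewrite /= linextU bilinextU scale1r. Qed.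

Lemma cochain0_functional (f : G -> K) : is_functional (cochain0 f).
Proof.
split=> [s t c u v | [//|s0 s] t _]; last by case: s.
case: s t => [|s0 s] [|t0 t] /=; first exact: linext_scalarP.
- by rewrite mulr0 addr0.
- by case: s => *; rewrite /= mulr0 addr0.
- by case: s => *; rewrite /= mulr0 addr0.
Qed.

Lemma cochain1_functional (f : G -> G -> K) :
  (forall g, f g 1%g = 0) -> is_functional (cochain1 f).
Proof.
move=> f1; split=> [s t c u v | [//|s0 [|s1 s]] [|t0 t] _] //=; last first.
- by case: s.
- by case: s.
- by apply: (@linext0f _ _ K^o) => g; rewrite linextU scale1r.
case: s t => [|s0 [|s1 s]] [|t0 [|t1 t]] /=.
all: try by [exact: bilinext_scalarPl | exact: bilinext_scalarPr
           | rewrite mulr0 addr0 | case: s => *; rewrite /= mulr0 addr0].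
Qed.

Lemma cochain2_functional (f : G -> G -> G -> K) :
  (forall g h, f g 1%g h = 0) -> (forall g h, f g h 1%g = 0) ->
  is_functional (cochain2 f).
Proof.
move=> f1l f1r; split=> [s t c u v | [//|s0 [|s1 [|s2 s]]] [|t0 [|t1 t]] _] //=.
- case: s t => [|s0 [|s1 [|s2 s]]] [|t0 [|t1 [|t2 t]]] /=.
  all: try by [exact: linext_scalarP | exact: linext_trilinearl
             | exact: linext_trilinearr | rewrite mulr0 addr0
             | case: s => *; rewrite /= mulr0 addr0].
- apply: (@linext0f _ _ K^o) => g.
  by rewrite /bilinext linextU scale1r; apply: linext0f.
- apply: (@linext0f _ _ K^o) => g; apply: (@linext0f _ _ K^o) => h.
  by rewrite linextU scale1r.
- by case: s.
- by case: s.
- by case: s.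
Qed.

Definition multilinear3 (F : A -> A -> A -> K) :=
  [/\ forall c u v a b, F (c *: u + v) a b = c * F u a b + F v a b,
      forall c u v a b, F a (c *: u + v) b = c * F a u b + F a v b &
      forall c u v a b, F a b (c *: u + v) = c * F a b u + F a b v].

(** This reduces the identities in degree 2 to triples of group elements. *)
Lemma multilinear3_ext (F F' : A -> A -> A -> K) :
  multilinear3 F -> multilinear3 F' ->
  (forall g h k, F (gbasis K g) (gbasis K h) (gbasis K k)
     = F' (gbasis K g) (gbasis K h) (gbasis K k)) ->
  forall a b c, F a b c = F' a b c.
Proof.
move=> [F1 F2 F3] [F1' F2' F3'] FF' a b c.
have at0 (f : A -> K) :
    (forall c u v, f (c *: u + v) = c * f u + f v) -> f 0 = 0.
  by move=> /(_ (-1) 0 0); rewrite scaler0 addr0 mulN1r addNr.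
elim/linext_ind: a => [k u v IHu IHv||g]; first by rewrite F1 F1' IHu IHv.
  by rewrite (at0 (F^~ _ ^~ _)) ?(at0 (F'^~ _ ^~ _)).
elim/linext_ind: b => [k u v IHu IHv||h]; first by rewrite F2 F2' IHu IHv.
  by rewrite (at0 (F _ ^~ _)) ?(at0 (F' _ ^~ _)).
elim/linext_ind: c => [k u v IHu IHv||k]; first by rewrite F3 F3' IHu IHv.
  by rewrite (at0 (F _ _)) ?(at0 (F' _ _)).
exact: FF'.
Qed.

Lemma cochain2_multilinear (f : G -> G -> G -> K) :
  multilinear3 (fun a b c : A => cochain2 f [:: a; b; c]).
Proof.
split=> c u v a b /=; first exact: linext_scalarP.
- exact: linext_trilinearl.
- exact: linext_trilinearr.
Qed.

Lemma cochain2B (f f' : G -> G -> G -> K) (a : seq A) :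
  cochain2 f a - cochain2 f' a
    = cochain2 (fun g h k => f g h k - f' g h k) a.
Proof.
case: a => [|a [|b [|c [|d s]]]]; rewrite ?subr0 //.
apply: (@multilinear3_ext (fun a b c => cochain2 f [:: a; b; c]
    - cochain2 f' [:: a; b; c]) (fun a b c => cochain2 _ [:: a; b; c])
  _ (cochain2_multilinear _)) => [|g h k]; last by rewrite !cochain2U.
have [f1 f2 f3] := cochain2_multilinear f.
have [f1' f2' f3'] := cochain2_multilinear f'.
split=> e u v a' b'.
- by rewrite f1 f1'; ring.
- by rewrite f2 f2'; ring.
- by rewrite f3 f3'; ring.
Qed.

End HomogeneousCochains.

(** * The operators on homogeneous functionals of low degree *)

Section LowDegree.
Variables (K : comNzRingType) (G : groupType).
Local Notation A := (group_algebra K G).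

Lemma op_b_cochain1 (f : G -> G -> K) (a : seq A) :
  op_b (cochain1 f) a = cochain2 (fun g0 g1 g2 =>
    f (g0 * g1)%g g2 - f g0 (g1 * g2)%g + f (g2 * g0)%g g1) a.
Proof.
case: a => [|a0 [|a1 [|a2 [|a3 a]]]] //.
- by rewrite /op_b /= big_ord1 /= mulr0 add0r mulr0.
- have -> : op_b (cochain1 f) [:: a0; a1; a2] =
    cochain1 f [:: a0 * a1; a2] - cochain1 f [:: a0; a1 * a2]
      + cochain1 f [:: a2 * a0; a1].
    rewrite /op_b /= !big_ord_recl big_ord0 /= expr0 expr1 mul1r mulN1r addr0.
    by rewrite expr2 mulrNN !mul1r.
  apply: (@multilinear3_ext K G
    (fun a0 a1 a2 => cochain1 f [:: a0 * a1; a2]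
      - cochain1 f [:: a0; a1 * a2] + cochain1 f [:: a2 * a0; a1])
    (fun a0 a1 a2 => cochain2 _ [:: a0; a1; a2]) _
    (cochain2_multilinear _)) => [|g h k].
    split=> c u v a b; rewrite /cochain1.
    (* The products are generalized so that unification does not unfold them. *)
    + rewrite (mulDZl c u v a) (mulDZr c u v b).
      move: (u * a) (v * a) (a * b) (b * u) (b * v) => ua va ab bu bv.
      rewrite !bilinext_scalarPl.
      ring.
    + rewrite (mulDZr c u v a) (mulDZl c u v b).
      move: (a * u) (a * v) (u * b) (v * b) (b * a) => au av ub vb ba.
      rewrite bilinext_scalarPl !bilinext_scalarPr.
      ring.
    + rewrite (mulDZl c u v a) (mulDZr c u v b).
      move: (a * b) (b * u) (b * v) (u * a) (v * a) => ab bu bv ua va.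
      rewrite bilinext_scalarPl !bilinext_scalarPr.
      ring.
  by rewrite cochain2U !gbasisM !cochain1U.
rewrite /op_b /= big1 ?add0r ?mulr0 // => -[i ilt] _ /=.
by case: i ilt => [|[|[|i]]] ilt /=; rewrite ?mulr0.
Qed.

Lemma op_B_cochain1 (f : G -> G -> K) (a : seq A) : a != [::] ->
  op_B (cochain1 f) a = cochain0 (f 1%g) a.
Proof.
case: a => [//|a0 [|a1 a]] _.
  rewrite /op_B /= big_ord1 /= mul1r /bilinext.
  by rewrite [LHS]linextU scale1r.
rewrite [RHS]/= /op_B big1 // => -[i ilt] _.
(* Every summand is the value of a functional of degree 1 on a tensor of
   degree at least 2. *)
set s := (X in cochain1 f (_ :: X)).
have : (1 < size s)%N.
  by rewrite /s size_cat addnC -size_cat cat_take_drop.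
by case: s => [|b0 [|b1 s]] //= _; rewrite mulr0.
Qed.

Variable w : G -> G -> K.
Local Notation D := (twist w).

(** B_D produces tensors that start with 1 and have a further factor, hence of
    positive degree. *)
Lemma op_BD_cochain0 (f : G -> K) (a : seq A) : op_BD D (cochain0 f) a = 0.
Proof.
rewrite /op_BD big1 // => j _; rewrite big1 // => k _.
set s := (X in cochain0 f (_ :: X)).
have : s != [::] by rewrite -size_eq0 /s size_cat /= addnS.
by case: s => [|b0 s] //= _; rewrite mulr0.
Qed.

Lemma op_iota_cochain0 (f : G -> K) (a : seq A) :
  op_iota D (cochain0 f) a
    = cochain2 (fun g0 g1 g2 => w g1 g2 * f (g1 * g2 * g0)%g) a.
Proof.
rewrite /op_iota op_BD_cochain0 subr0.
case: a => [|a0 [|a1 [|a2 [|a3 a]]]] //.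
apply: (@multilinear3_ext K G
    (fun a0 a1 a2 => op_bD D (cochain0 f) [:: a0; a1; a2])
    (fun a0 a1 a2 => cochain2 _ [:: a0; a1; a2])
    _ (cochain2_multilinear _)) => [|g h k].
  split=> c u v a b; rewrite /op_bD /=.
  - by rewrite mulrDr -scalerAr linext_scalarP.
  - by rewrite [D _ _]bilinextDZl mulrDl -scalerAl linext_scalarP.
  - by rewrite [D _ _]bilinextDZr mulrDl -scalerAl linext_scalarP.
rewrite cochain2U /op_bD /=.
by rewrite [D _ _]bilinextU -scalerAl gbasisM linearZ /= linextU scale1r.
Qed.

End LowDegree.

(** * The gauge transformation on the action groupoid *)

Section Groupoid.
Variables (K : comNzRingType) (G : groupType) (x : G).
Local Notation A := (group_algebra K G).
Local Notation p := (@centraliser_proj G x).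
Local Notation "[ 'C' g ]" := (to_centraliser x g).
Variables (omega0 : G -> G -> K).
Variables (omegat : centraliser_quotient x -> centraliser_quotient x -> K).
Variables (psi : centraliser x -> K) (sel : G -> G).

Hypothesis omega0_cocycle : normalized_cocycle omega0.
Hypothesis omegat_cocycle : normalized_cocycle omegat.
Hypothesis psi_coboundary : forall g h : centraliser x,
  omega0 (val g) (val h) - psi g - psi h + psi (g * h)%g = omegat (p g) (p h).
Hypothesis selP : forall y, Ad x y -> ((sel y)^-1 * x * sel y)%g = y.

Lemma Ad_mulC g h : Ad x (g * h)%g -> Ad x (h * g)%g.
Proof.
case=> k ghE; exists (k * g)%g.
by rewrite conjgM -ghE conjgE !mulgA mulVg mul1g.
Qed.

Lemma asbool_Ad_mulC g h : `[< Ad x (g * h)%g >] = `[< Ad x (h * g)%g >].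
Proof. by apply/asboolP/asboolP; apply: Ad_mulC. Qed.

Lemma to_centraliserK g : g \in cent x -> val [C g] = g.
Proof. exact: insubdK. Qed.

Lemma to_centraliser1 : [C 1%g] = 1%g.
Proof. by apply: val_inj; rewrite to_centraliserK // inE mulg1 mul1g. Qed.

Lemma sel_mul y : Ad x y -> (x * sel y = sel y * y)%g.
Proof. by move=> Ay; rewrite -{3}(selP Ay) !mulgA mulgV mul1g. Qed.

Lemma sel_conj y : Ad x y -> (sel y * y * (sel y)^-1 = x)%g.
Proof. by move=> Ay; rewrite -sel_mul // mulgK. Qed.

(** The functor from the action groupoid to C_G(x) takes its values in C_G(x)
    because conjugating by g^y, by the arrow and by g^{y'} all turn the marked
    elements x, y, y', x into one another. *)
Lemma arrow_cent g y y' : Ad x y -> Ad x y' -> (g * y = y' * g)%g ->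
  (sel y' * g * (sel y)^-1)%g \in cent x.
Proof.
move=> Ay Ay' gy; rewrite inE; apply/eqP.
rewrite !mulgA sel_mul // -[(sel y' * y' * g)%g]mulgA -gy.
by rewrite -[in RHS](sel_conj Ay) !mulgA mulgVK.
Qed.

(** The function psi transported to an arrow g of the action groupoid, with s
    and t the elements chosen for its target and its source.  With
    h = s g t^-1, the correction terms compare the two factorizations of
    g t^-1 = s^-1 h: in the group algebra twisted by omega0, they are what
    turns the product of g and t^-1 into that of s^-1 and h. *)
Definition arrow_psi (s t g : G) : K :=
  psi [C (s * g * t^-1)%g] + omega0 g t^-1%g - omega0 s^-1%g (s * g * t^-1)%g.

(** For composable arrows g' and g, with h = s g t^-1 and k = t g' u^-1, the
    correction terms turn omega0 (h, k) into omega0 (g, g'): these are three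
    instances of the cocycle identity, along s^-1 h = g t^-1 and
    t^-1 k = g' u^-1. *)
Lemma arrow_psi_coboundary s t u g g' :
  (s * g * t^-1)%g \in cent x -> (t * g' * u^-1)%g \in cent x ->
  omega0 g g' - arrow_psi s t g - arrow_psi t u g' + arrow_psi s u (g * g')%g
    = omegat (p [C (s * g * t^-1)%g]) (p [C (t * g' * u^-1)%g]).
Proof.
have [coc _ _ _] := omega0_cocycle.
set h := (s * g * t^-1)%g; set k := (t * g' * u^-1)%g => hC kC.
have hkE : (s * (g * g') * u^-1 = h * k)%g by rewrite /h /k !mulgA mulgVK.
have hkC : (h * k)%g \in cent x.
  exact: (group_closedM (cent_group_closed x)).
have C_hk : [C (h * k)%g] = ([C h] * [C k])%g.
  by apply: val_inj; rewrite valM !to_centraliserK.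
rewrite -psi_coboundary !to_centraliserK // /arrow_psi hkE -/h -/k C_hk.
have sh : (s^-1 * h = g * t^-1)%g by rewrite /h !mulgA mulVg mul1g.
have tk : (t^-1 * k = g' * u^-1)%g by rewrite /k !mulgA mulVg mul1g.
have e1 : omega0 g' u^-1%g
    = omega0 g g' + omega0 (g * g')%g u^-1%g - omega0 g (g' * u^-1)%g.
  by rewrite -coc addrK.
have e2 : omega0 g (g' * u^-1)%g
    = omega0 g t^-1%g + omega0 (g * t^-1)%g k - omega0 t^-1%g k.
  by rewrite -coc tk addrC addKr.
have e3 : omega0 h k
    = omega0 s^-1%g h + omega0 (g * t^-1)%g k - omega0 s^-1%g (h * k)%g.
  by rewrite -sh -coc addrK.
by rewrite e3 e1 e2; ring.
Qed.

Lemma psi1 : psi 1%g = 0.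
Proof.
have [_ w1 _ _] := omega0_cocycle; have [_ wt1 _ _] := omegat_cocycle.
have := psi_coboundary 1%g 1%g.
rewrite [omegat _ _]wt1 [omega0 _ _]w1 mulg1 sub0r subrK => /eqP.
by rewrite oppr_eq0 => /eqP.
Qed.

(** An identity arrow goes to 1, where normalization kills every term. *)
Lemma arrow_psi1 s : arrow_psi s s 1%g = 0.
Proof.
have [_ w1 w1r _] := omega0_cocycle.
by rewrite /arrow_psi mulg1 mulgV to_centraliser1 psi1 w1 w1r !subr0 add0r.
Qed.

(** The arrow y from y to itself is sent to x; the cocycle identity along
    s^-1, s y, s^-1 puts the correction terms in the form used for xi. *)
Lemma arrow_psi_loop y : Ad x y ->
  arrow_psi (sel y) (sel y) y
    = psi [C x] + omega0 (sel y * y)%g (sel y)^-1%g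
      - omega0 (sel y)^-1%g (sel y * y)%g.
Proof.
move=> Ay; have [coc _ _ _] := omega0_cocycle.
rewrite /arrow_psi sel_conj //.
have := coc (sel y)^-1%g (sel y * y)%g (sel y)^-1%g.
rewrite sel_conj // mulgA mulVg mul1g => e.
have -> : omega0 y (sel y)^-1%g = omega0 (sel y * y)%g (sel y)^-1%g
    + omega0 (sel y)^-1%g x - omega0 (sel y)^-1%g (sel y * y)%g.
  by rewrite e addrC addKr.
ring.
Qed.

Local Notation theta_fun := (fun g0 g1 : G => if `[< Ad x (g0 * g1)%g >] then
  arrow_psi (sel (g1 * g0)%g) (sel (g0 * g1)%g) g1 else 0).

Lemma theta_functional : is_functional (theta_cochain omega0 sel psi).
Proof.
apply: (@cochain1_functional _ _ theta_fun) => g.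
by case: asboolP => // _; rewrite mulg1 mul1g arrow_psi1.
Qed.

Lemma cup_functional : is_functional (cup_cochain sel omegat : cochain A).
Proof.
have [_ wt1 wt1r _] := omegat_cocycle.
apply: cochain2_functional => g h; case: asboolP => // _ /=.
- by rewrite !mulg1 mul1g mulgV to_centraliser1; apply: wt1.
- by rewrite !mulg1 mul1g mulgV to_centraliser1; apply: wt1r.
Qed.

Lemma iota_tau_functional :
  is_functional (op_iota (twist omega0) (tau_cochain K x)).
Proof.
have [_ w1 w1r _] := omega0_cocycle.
rewrite /tau_cochain (funext (op_iota_cochain0 omega0 _)).
by apply: cochain2_functional => g h; rewrite ?w1 ?w1r mul0r.
Qed.

(** The coboundary of [arrow_psi] at the composable arrows g1 and g2.  All
    cyclic rotations of g0 g1 g2 are conjugate, so either every case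
    distinction on Ad_G(x) succeeds or none does. *)
Lemma theta_coboundary g0 g1 g2 :
  theta_fun (g0 * g1)%g g2 - theta_fun g0 (g1 * g2)%g + theta_fun (g2 * g0)%g g1
    = omega0 g1 g2 * (if `[< Ad x (g1 * g2 * g0)%g >] then 1 else 0)
      - (if `[< Ad x (g0 * g1 * g2)%g >] then
           omegat (p (Xi x sel g0 g1 g2).1) (p (Xi x sel g0 g1 g2).2) else 0).
Proof.
have y01 := asbool_Ad_mulC g0 (g1 * g2)%g.
have y02 := asbool_Ad_mulC (g0 * g1)%g g2.
rewrite !mulgA in y01 y02 *; rewrite -y01 -y02.
case: asboolP => [A0|_]; last by rewrite mulr0 !subr0 addr0.
have A1 : Ad x (g1 * g2 * g0)%g by apply/asboolP; rewrite -y01; apply/asboolP.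
have A2 : Ad x (g2 * g0 * g1)%g by apply/asboolP; rewrite -y02; apply/asboolP.
rewrite mulr1 /= -arrow_psi_coboundary.
- ring.
- by apply: arrow_cent; rewrite ?mulgA.
- by apply: arrow_cent; rewrite ?mulgA.
Qed.

(** B theta in degree 0 reads off the loops y from y to itself. *)
Lemma xi_theta (a : A) :
  xi_cochain omega0 sel psi [:: a] = cochain0 (theta_fun 1%g) [:: a].
Proof.
apply: (@eq_linext _ _ K^o) => y; rewrite mul1g mulg1.
by case: asboolP => // Ay; rewrite arrow_psi_loop.
Qed.

Lemma transgression_formula (a : seq A) : a != [::] ->
  - xi_cochain omega0 sel psi a + op_iota (twist omega0) (tau_cochain K x) a
    - cup_cochain sel omegat a
  = op_b (theta_cochain omega0 sel psi) a
    - op_B (theta_cochain omega0 sel psi) a.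
Proof.
move=> a0; rewrite (op_b_cochain1 theta_fun) (op_B_cochain1 theta_fun a0).
rewrite op_iota_cochain0.
case: a a0 => [|b0 [|b1 [|b2 [|b3 a]]]] // _.
- by rewrite xi_theta /= addr0 subr0 sub0r.
- by rewrite /= oppr0 !addr0.
- rewrite /xi_cochain !cochain0_pos oppr0 add0r addr0.
  rewrite cochain2B; congr (cochain2 _ _).
  by do 3![apply: funext => ?]; rewrite theta_coboundary.
- by rewrite /= oppr0 !addr0.
Qed.

End Groupoid.

Theorem proposition3p6 (R : realType) (G : groupType) (x : G)
    (omega0 : G -> G -> R[i])
    (omegat : centraliser_quotient x -> centraliser_quotient x -> R[i])
    (psi : centraliser x -> R[i]) (sel : G -> G) :
  finite_order x ->
  normalized_cocycle omega0 ->
  normalized_cocycle omegat ->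
  (forall g h : centraliser x,
     omega0 (val g) (val h) - psi g - psi h + psi (g * h)%g
       = omegat (centraliser_proj g) (centraliser_proj h)) ->
  (forall y : G, Ad x y -> ((sel y)^-1 * x * sel y)%g = y) ->
  let D := twist omega0 in
  let tau := tau_cochain R[i] x in
  let xi := xi_cochain omega0 sel psi in
  let theta := theta_cochain omega0 sel psi in
  let tau_cup_omega := cup_cochain sel omegat in
  [/\ is_functional xi, is_functional (op_iota D tau),
      is_functional tau_cup_omega, is_functional theta
    & forall (n : nat) (a : n.+1.-tuple (group_algebra R[i] G)),
        - xi a + op_iota D tau a - tau_cup_omega a
          = op_b theta a - op_B theta a].
Proof.
move=> _ om omt psiE selE D tau xi theta tau_cup_omega; split.
- exact: cochain0_functional.
- exact: iota_tau_functional.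
- exact: cup_functional.
- exact: (theta_functional sel om omt psiE).
- move=> n a; apply: (transgression_formula om psiE selE).
  by rewrite -size_eq0 size_tuple.
Qed.
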